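(* Let $A$ and $B$ be abelian groups, let $\phi: B \to \operatorname{Aut}(A)$ be a homomorphism, and let $G$ be a finite group isomorphic to $A \rtimes_{\phi} B$. Then $G$ has a basis.
   Context: Basis: Let $G$ be a finite group with identity $e$, and write $|b|$ for the order of an element $b$. A tuple $(b_1,\ldots,b_n) \in (G\setminus\{e\})^n$ is a basis for $G$ if for every $g \in G$ there is a unique tuple $(a_1,\ldots,a_n)$ with $a_i \in \{0,\ldots,|b_i|-1\}$ for all $i$ such that $g = b_1^{a_1}\cdots b_n^{a_n}$ (the product taken in this order). The trivial group $\{e\}$ is said to have a trivial basis (the empty tuple), and so counts as having a basis. Semidirect product: writing $\phi_b = \phi(b)$, the semidirect product $A \rtimes_{\phi} B$ is the set $\{(b,a) \mid b \in B, a \in A\}$ with the operation $(b_1,a_1)(b_2,a_2) = (b_1b_2, \phi_{b_2}(a_1)a_2)$. *)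

(* Defs.v *)
From HB Require Import structures.
From mathcomp Require Import all_boot all_fingroup.

Set Implicit Arguments.
Unset Strict Implicit.
Unset Printing Implicit Defensive.

Local Open Scope group_scope.

Definition abelian_group (G : groupType) : Prop :=
  forall x y : G, commute x y.

Definition isomorphic (G H : groupType) : Prop :=
  exists f : {multiplicative G -> H}, bijective f.

(* Homomorphisms B -> Aut(A). Products in Aut(A) are composed from left to
   right (as for {perm _}): this is the convention under which the semidirect
   product law below is associative for every B. When B is abelian, the
   opposite convention gives the same maps. *)
Record autHom (B A : groupType) := AutHom {
  aut_fun :> B -> {multiplicative A -> A};
  aut_fun_bij : forall b, bijective (aut_fun b);
  aut_funM : forall b1 b2, aut_fun (b1 * b2) =1 aut_fun b2 \o aut_fun b1
}.

(* MathComp's sdprod_by has the same multiplication law, but only for finite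
   groups. The one-constructor wrapper keeps the group structure apart from
   the direct product structure that B * A already carries. *)
Record semidirect (B A : groupType) (phi : autHom B A) :=
  SDPair { sd_pair : B * A }.

Section SemidirectProduct.
Variables (B A : groupType) (phi : autHom B A).
Implicit Types u v w : semidirect phi.

HB.instance Definition _ := [isNew for @sd_pair B A phi].
HB.instance Definition _ := [Choice of semidirect phi by <:].

Definition sd_mul u v : semidirect phi :=
  SDPair phi ((sd_pair u).1 * (sd_pair v).1,
              phi (sd_pair v).1 (sd_pair u).2 * (sd_pair v).2).

Definition sd_one : semidirect phi := SDPair phi (1, 1).

Definition sd_inv u : semidirect phi :=
  SDPair phi ((sd_pair u).1^-1, phi (sd_pair u).1^-1 (sd_pair u).2^-1).

Fact aut_fun_gmulf1 b : phi b 1 = 1.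
Proof. by apply: (@mulgI _ (phi b 1)); rewrite -gmulfM !mulg1. Qed.

Fact aut_fun1 a : phi 1 a = a.
Proof.
have /bij_inj := aut_fun_bij phi 1; apply.
by have := aut_funM phi 1 1 a; rewrite mulg1 /= => <-.
Qed.

Fact sd_mulA : associative sd_mul.
Proof.
move=> [[b1 a1]] [[b2 a2]] [[b3 a3]]; congr SDPair => /=.
by rewrite gmulfM aut_funM /= !mulgA.
Qed.

Fact sd_mul1 : left_id sd_one sd_mul.
Proof. by move=> [[b a]]; congr SDPair; rewrite /= aut_fun_gmulf1 !mul1g. Qed.

Fact sd_mulr1 : right_id sd_one sd_mul.
Proof. by move=> [[b a]]; congr SDPair; rewrite /= aut_fun1 !mulg1. Qed.

Fact sd_mulV : left_inverse sd_one sd_inv sd_mul.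
Proof.
move=> [[b a]]; congr SDPair => /=.
by rewrite -[phi b _]aut_funM !mulVg aut_fun1 mulVg.
Qed.

Fact sd_mulrV : right_inverse sd_one sd_inv sd_mul.
Proof.
by move=> [[b a]]; congr SDPair; rewrite /= -gmulfM !mulgV aut_fun_gmulf1.
Qed.

HB.instance Definition _ :=
  isGroup.Build (semidirect phi) sd_mulA sd_mul1 sd_mulr1 sd_mulV sd_mulrV.

End SemidirectProduct.

Definition is_basis (G : finGroupType) (n : nat) (b : n.-tuple G) : Prop :=
  (forall i, tnth b i != 1) /\
  (forall g : G, exists! a : n.-tuple nat,
     (forall i, tnth a i < #[tnth b i])%N /\
     g = \prod_(i < n) tnth b i ^+ tnth a i).

(* The case n = 0 is the trivial basis: the empty product is 1, so it is a
   basis exactly when G is trivial. *)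
Definition has_basis (G : finGroupType) : Prop :=
  exists (n : nat) (b : n.-tuple G), is_basis b.

(* Main.v *)
Require Import Defs.
From mathcomp Require Import all_boot all_fingroup all_solvable.

(** The copies K and H of B and A inside G are abelian subgroups with
    G = K H and K :&: H = 1, so each g in G factors uniquely as k h. By the
    structure theorem K and H are direct products of nontrivial cyclic groups,
    whose generators form bases of K and H; concatenating the two gives a basis
    of G. *)

Set Implicit Arguments.
Unset Strict Implicit.
Unset Printing Implicit Defensive.

Local Open Scope group_scope.

Section SequenceBases.
Variable gT : finGroupType.
Implicit Types (x y g : gT) (s t : seq gT) (a b : seq nat) (K H : {group gT}).

(** Plain sequences are used rather than tuples, so that bases can be concatenated without casts on
    lengths. [zip] truncates to the shorter list, but [all2] in [below_orders] forces equal
    lengths. *)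
Definition exp_prod s a := \prod_(p <- zip s a) p.1 ^+ p.2.

Definition below_orders s a := all2 (fun x k => k < #[x])%N s a.

(** [S] is a mere set, so that the notion applies directly to the set product [K * H]. *)
Definition basis_of (S : {set gT}) s :=
  [/\ {subset s <= S}, 1 \notin s &
      {in S, forall g, exists! a, below_orders s a /\ g = exp_prod s a}].

Lemma below_orders_size s a : below_orders s a -> size a = size s.
Proof. by rewrite /below_orders all2E => /andP[/eqP]. Qed.

Lemma below_orders_cat s t a b : size a = size s ->
  below_orders (s ++ t) (a ++ b) = below_orders s a && below_orders t b.
Proof.
move=> sz; rewrite /below_orders !all2E !size_cat sz eqn_add2l eqxx /=.
by rewrite zip_cat // all_cat andbCA.
Qed.

Lemma exp_prod_cat s t a b : size a = size s ->
  exp_prod (s ++ t) (a ++ b) = exp_prod s a * exp_prod t b.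
Proof. by move=> sz; rewrite /exp_prod zip_cat // big_cat. Qed.

Lemma mem_exp_prod K s a : {subset s <= K} -> exp_prod s a \in K.
Proof.
rewrite /exp_prod; elim: s a => [|x s IHs] [|k a] sK; rewrite /= ?big_nil //.
rewrite big_cons groupM ?groupX ?(sK x) ?mem_head //.
by apply: IHs => y ys; rewrite sK // inE ys orbT.
Qed.

(** Uniqueness: if k h = k' h', then k'^-1 k = h' h^-1 lies in both [K] and [H], hence is 1; so k =
    k' and h = h', and uniqueness in each factor applies. *)
Lemma basis_of_cat K H s t :
  K :&: H = 1 -> basis_of K s -> basis_of H t -> basis_of (K * H) (s ++ t).
Proof.
move=> tiKH [sK s1 sP] [tH t1 tP]; split.
- move=> x; rewrite mem_cat => /orP[/sK xK|/tH xH].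
    by rewrite -[x]mulg1 mem_mulg.
  by rewrite -[x]mul1g mem_mulg.
- by rewrite mem_cat negb_or s1.
move=> _ /mulsgP[k h kK hH ->].
have [a [[sa ->] aU]] := sP k kK; have [b [[tb ->] bU]] := tP h hH.
have sza := below_orders_size sa.
exists (a ++ b); split; first by rewrite below_orders_cat // sa tb exp_prod_cat.
move=> c [stc].
have szc := below_orders_size stc; rewrite size_cat in szc.
(* Cut the competing exponent sequence [c] at [size s] into exponents for [s] and for [t]. *)
have sz1 : size (take (size s) c) = size s.
  by rewrite size_take_min szc (minn_idPl (leq_addr _ _)).
move: stc; rewrite -{1 2}(cat_take_drop (size s) c) below_orders_cat //.
case/andP=> sc tc; rewrite exp_prod_cat //.
set a' := take _ _ in sc *; set b' := drop _ _ in tc *.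
have memK d := mem_exp_prod d sK; have memH d := mem_exp_prod d tH.
move=> eq_prod.
have eqK :
  (exp_prod s a')^-1 * exp_prod s a = exp_prod t b' * (exp_prod t b)^-1.
  by apply: (mulIg (exp_prod t b)); rewrite mulgKV -mulgA eq_prod mulKg.
have /set1gP/eqP eq1 : (exp_prod s a')^-1 * exp_prod s a \in [1 gT].
  by rewrite -tiKH inE {2}eqK !groupM ?groupV ?memK ?memH.
have ea : exp_prod s a = exp_prod s a'.
  by apply/esym/eqP; rewrite eq_mulVg1.
move: eq1; rewrite eqK -eq_mulgV1 => /eqP eb.
by rewrite -(cat_take_drop (size s) c) -/a' -/b' (aU a') // (bU b').
Qed.

Lemma basis_of_nil : basis_of [1 gT] [::].
Proof.
split=> // _ /set1gP->; exists [::]; split; first by rewrite /exp_prod big_nil.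
by case=> // k a [].
Qed.

Lemma basis_of_cycle x : x != 1 -> basis_of <[x]> [:: x].
Proof.
move=> x1; split=> [y|| g]; first by rewrite inE => /eqP->; apply: cycle_id.
  by rewrite inE eq_sym.
have exp1 k : exp_prod [:: x] [:: k] = x ^+ k by rewrite /exp_prod /= big_seq1.
case/cyclePmin=> k ltk ->; exists [:: k]; split=> [|a [xa]].
  by rewrite /below_orders /= ltk exp1.
(* The bound leaves only sequences of length one; two exponents below the order that are congruent
   modulo it coincide. *)
case: a xa => [|l [|? ?]] //=; rewrite /below_orders /= ?andbF // andbT => ltl.
by move/eqP; rewrite exp1 eq_expg_mod_order !modn_small // => /eqP->.
Qed.

Lemma basis_of_bigdprod s K :
  1 \notin s -> \big[dprod/1]_(x <- s) <[x]> = K -> basis_of K s.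
Proof.
elim: s K => [|x s IHs] K.
  by rewrite big_nil => _ <-; apply: basis_of_nil.
rewrite inE negb_or eq_sym => /andP[x1 s1]; rewrite big_cons.
case/dprodP=> [[L H eqL eqH] <- _]; rewrite eqL eqH => tiLH.
apply: (@basis_of_cat L H [:: x]) => //; last exact: IHs.
by rewrite -eqL; apply: basis_of_cycle.
Qed.

Lemma abelian_basis K : abelian K -> exists s, basis_of K s.
Proof.
case/abelian_structure=> s defK ordK; exists s; apply: basis_of_bigdprod defK.
(* A generator equal to 1 would put the order 1 in [abelian_type K], whose entries all exceed 1. *)
apply/negP=> s1; have : #[1 : gT] \in abelian_type K by rewrite -ordK map_f.
by rewrite order1 => /(allP (abelian_type_gt1 K)).
Qed.

Lemma exp_prodE n (s : n.-tuple gT) (a : n.-tuple nat) :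
  exp_prod s a = \prod_(i < n) tnth s i ^+ tnth a i.
Proof.
rewrite /exp_prod (big_nth (1, 0%N)) size_zip !size_tuple minnn big_mkord.
by apply: eq_bigr => i _; rewrite nth_zip ?size_tuple //= -!tnth_nth.
Qed.

Lemma below_ordersP n (s : n.-tuple gT) (a : n.-tuple nat) :
  reflect (forall i, tnth a i < #[tnth s i])%N (below_orders s a).
Proof.
rewrite /below_orders all2E !size_tuple eqxx /=.
apply: (iffP (all_nthP (1, 0%N))) => [lt_as i | lt_as i].
  have:= lt_as i; rewrite size_zip !size_tuple minnn => /(_ (ltn_ord i)).
  by rewrite nth_zip ?size_tuple //= -!tnth_nth.
rewrite size_zip !size_tuple minnn => ltin.
rewrite nth_zip ?size_tuple //=.
by have:= lt_as (Ordinal ltin); rewrite !(tnth_nth 1, tnth_nth 0%N).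
Qed.

(** The order bound fixes the length of an exponent sequence, so it can be repackaged as a tuple. *)
Lemma basis_of_has_basis s : basis_of [set: gT] s -> has_basis gT.
Proof.
case=> _ s1 sP; exists (size s), (in_tuple s); split=> [i | g].
  by apply: contraNneq s1 => <-; apply: mem_tnth.
have [a [[sa ->] aU]] := sP g (in_setT g).
have sz : size a == size s by rewrite (below_orders_size sa).
exists (Tuple sz); split=> [|b [/below_ordersP sb def_g]].
  by split; [apply/below_ordersP | rewrite -exp_prodE].
by apply/val_inj/aU; rewrite def_g -exp_prodE.
Qed.

Lemma abelian_complements_has_basis K H :
  abelian K -> abelian H -> K :&: H = 1 -> K * H = [set: gT] -> has_basis gT.
Proof.
move=> /abelian_basis[s Ks] /abelian_basis[t Ht] tiKH defG.
by apply: (@basis_of_has_basis (s ++ t)); rewrite -defG; apply: basis_of_cat.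
Qed.

End SequenceBases.

Theorem corollary2p2 (A B : groupType) (hA : abelian_group A)
    (hB : abelian_group B) (phi : autHom B A) (G : finGroupType)
    (hG : isomorphic G (semidirect phi)) :
  has_basis G.
Proof.
case: hG => f [f' fK f'K].
have f_inj := can_inj fK.
have fM x y : sd_pair (f (x * y)) = ((sd_pair (f x)).1 * (sd_pair (f y)).1,
    phi (sd_pair (f y)).1 (sd_pair (f x)).2 * (sd_pair (f y)).2).
  by rewrite gmulfM.
have f1 : sd_pair (f 1) = (1, 1).
  suff -> : f 1 = 1 by [].
  by apply: (@mulgI _ (f 1)); rewrite -gmulfM !mulg1.
have f_pair x y : sd_pair (f x) = sd_pair (f y) -> x = y.
  by move=> e; apply: f_inj; case: (f x) (f y) e => [?] [?] /= ->.
(* [Kset] corresponds to the pairs (b, 1), a copy of [B], and [Hset] to the pairs (1, a), a copy of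
   [A]. *)
pose Kset := [set g : G | (sd_pair (f g)).2 == 1].
pose Hset := [set g : G | (sd_pair (f g)).1 == 1].
have Kgroup : group_set Kset.
  apply/group_setP; split=> [|x y]; rewrite !inE ?f1 //= => /eqP x1 /eqP y1.
  by rewrite fM /= x1 y1 aut_fun_gmulf1 mulg1.
have Hgroup : group_set Hset.
  apply/group_setP; split=> [|x y]; rewrite !inE ?f1 //= => /eqP x1 /eqP y1.
  by rewrite fM /= x1 y1 mulg1.
apply: (@abelian_complements_has_basis G (Group Kgroup) (Group Hgroup)).
(* The twist disappears on both subgroups: each [phi b] fixes 1, and [phi 1] is the identity. *)
- apply/centsP=> x; rewrite inE => /eqP x1 y; rewrite inE => /eqP y1.
  by apply: f_pair; rewrite !fM x1 y1 !aut_fun_gmulf1 hB.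
- apply/centsP=> x; rewrite inE => /eqP x1 y; rewrite inE => /eqP y1.
  by apply: f_pair; rewrite !fM x1 y1 !aut_fun1 hA.
- apply/setP=> x; rewrite !inE; apply/andP/eqP=> [[/eqP x2 /eqP x1]|->].
    by apply: f_pair; rewrite f1 -x1 -[in RHS]x2 -surjective_pairing.
  by rewrite f1.
apply/setP=> g; rewrite inE; apply/mulsgP.
(* The factorization is (b, a) = (b, 1)(1, a), where the twist is by [phi 1]. *)
exists (f' (SDPair phi ((sd_pair (f g)).1, 1)))
       (f' (SDPair phi (1, (sd_pair (f g)).2))); rewrite ?inE ?f'K //.
by apply: f_pair; rewrite fM !f'K /= aut_fun1 mulg1 mul1g -surjective_pairing.
Qed.
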